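(* There exist a continuous function $\omega:[0,+\infty)\to[0,+\infty)$ and a measurable function $u:(0,1)\to\mathbb{R}$ that is not essentially constant such that all of the following hold: (a) $\omega(\mu)>0$ for every $\mu>0$; (b) $\displaystyle\int_1^{+\infty}\frac{\omega(\mu)}{\mu^2}\,d\mu=+\infty$; (c) $\displaystyle\iint_{(0,1)\times(0,1)}\omega\left(\frac{|u(y)-u(x)|}{|y-x|}\right)\frac{1}{|y-x|}\,dx\,dy<+\infty$; (d) $\displaystyle\lim_{\mu\to+\infty}\frac{\omega(\mu)}{(\log\mu)^{\theta}}=+\infty$ for every $\theta>0$; (e) for almost every $x\in(0,1)$ the derivative of $u$ at $x$ exists and is equal to $0$.
   Context: A measurable function is essentially constant if it coincides almost everywhere (with respect to Lebesgue measure) with a constant. *)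

(* Defs.v *)
From HB Require Import structures.
From mathcomp Require Import all_boot all_order all_algebra.
From mathcomp Require Import all_classical all_reals all_analysis.

Set Implicit Arguments.
Unset Strict Implicit.
Unset Printing Implicit Defensive.

Import Order.TTheory GRing.Theory Num.Theory.
Import numFieldNormedType.Exports.

Local Open Scope classical_set_scope.
Local Open Scope ring_scope.

Definition essentially_constant (R : realType) (D : set R) (u : R -> R) : Prop :=
  exists c : R, {ae (@lebesgue_measure R), forall x, D x -> u x = c}.

(* Main.v *)
Require Import Defs.
From HB Require Import structures.
From mathcomp Require Import all_boot all_order all_algebra.
From mathcomp Require Import all_classical all_reals all_analysis.
From mathcomp Require Import measurable_realfun.
From mathcomp Require Import ring lra.
From mathcomp Require Import zify.

Set Implicit Arguments.
Unset Strict Implicit.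
Unset Printing Implicit Defensive.

Import Order.TTheory GRing.Theory Num.Theory.
Import numFieldNormedType.Exports.

Local Open Scope classical_set_scope.
Local Open Scope ring_scope.

(** For a function with a single jump the double integral is, up to constants,
    the divergent integral of [omega m / m ^+ 2].  Hence [u] must have no
    isolated jump, and the weight [omega] must owe the divergence of its
    integral to slopes which [u] does not have.

    The function [u] is [profile].  Folding the unit interval repeatedly gives
    the 1-Lipschitz functions [tent k]; the open sets [plateau k], where
    [tent k] exceeds [len k], are the level-[k] gaps of a Cantor set of measure
    zero, and [u] equals [height k] on the level-[k] gaps.  Two facts drive
    everything.
    - Separation ([plateau_sep]): a point of a level-[k] gap is at distance more
      than [len k] from all gaps of lower level.
    - Size ([measure_band]): the points surviving after level [k] have measure
      at most [2 ^+ k.+1 * len k].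
    As the heights grow so fast that [height k / len k = top k] is far below
    [height k.+1], every difference quotient of [u] between points of the gaps
    lies in the set [slopes], the union of [0] and of the intervals from
    [height k / 2] to [top k]; these intervals leave long gaps between them.

    The weight is [root8 m + dist slopes m ^+ 2].  On the slopes of [u] only the
    eighth root remains, which is still larger than every power of the
    logarithm.  Far from [slopes] the squared distance dominates: on the
    interval from [2 * top k] to [3 * top k] it makes [weight m / m ^+ 2] at
    least [9^-1], and the length of this interval is unbounded in [k].

    For the double integral, consider pairs whose higher level is [k.+1].  The weight is at most
    [root8 (top k.+1)], and the distance lies between [len k.+1] and [1].
    Splitting this range into dyadic scales, each of the [expo k.+1] scales
    contributes the same amount, of the order of the weight times the measure
    of the surviving points, which is about [2 ^+ k * len k].  With
    [expo k = 32 * 2 ^ k] these quantities are [2 ^ (24 * 2 ^ k)] and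
    [2 ^ (k - 32 * 2 ^ k)], so the sum over [k] converges ([strip_sum_le],
    [integral_energy_fin]).

    Finally [u] is locally constant on the union of the gaps, an open set of
    full measure, so its derivative vanishes almost everywhere. *)

(** * Auxiliary facts on the real line *)

Lemma lipschitz1_continuous (R : realType) (f : R -> R) :
  (forall x y, f y - f x <= `|y - x|) -> continuous f.
Proof.
move=> fL x; apply/cvgrPdist_lt => e e0; near=> y.
apply: (@le_lt_trans _ _ `|x - y|); last by near: y; exact: cvgr_dist_lt.
have := fL x y; have := fL y x; rewrite distrC => ? ?.
by rewrite ler_norml; apply/andP; split; lra.
Unshelve. all: by end_near. Qed.

(** The inverse is reduced to a real power of the nonnegative number [x ^+ 2],
    for which measurability is known; both sides vanish at [0]. *)
Lemma measurable_invr (R : realType) : measurable_fun setT (@GRing.inv R).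
Proof.
rewrite (_ : @GRing.inv R = fun x => x * (x ^+ 2) `^ (-1)).
  apply: measurable_funM => //; apply: (measurableT_comp (measurable_powR _)).
  exact: measurable_funX.
apply/funext => x; rewrite powR_inv1 ?sqr_ge0//.
by have [->|x0] := eqVneq x 0; [rewrite invr0 mul0r|field].
Qed.

Lemma ae_open_exists (R : realType) (U D : set R) (P : R -> Prop) :
  open U -> U !=set0 -> U `<=` D ->
  {ae @lebesgue_measure R, forall x, D x -> P x} -> exists2 x, U x & P x.
Proof.
move=> oU [x Ux] UD [N [mN N0 DP]].
have /nbhs_ballP[e /= e0 xeU] := open_nbhs_nbhs (conj oU Ux).
apply: contrapT => UP; have : (lebesgue_measure (ball x e) <= lebesgue_measure N)%E.
  apply: le_measure; rewrite ?inE//; first exact: measurable_ball.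
  move=> y /xeU Uy; apply: DP => /= DPy.
  by apply: UP; exists y => //; apply: DPy; exact: UD.
rewrite N0 (lebesgue_measure_ball x (ltW e0)) lee_fin leNgt.
by rewrite pmulrn_lgt0 ?e0.
Qed.

(** Instead of integrating [d^-1] between [2 ^- N] and [1], a pair at distance
    [d] is charged to one of [N] dyadic scales. *)
Lemma dyadic_scale (R : realFieldType) (d : R) (N : nat) :
  d < 1 -> (2 ^+ N)^-1 <= d ->
  exists n, [/\ (n < N)%N, d < (2 ^+ n)^-1 & d^-1 <= 2 ^+ n.+1].
Proof.
move=> d1; elim: N => [|N ih] dN.
  by move: dN; rewrite expr0 invr1 leNgt d1.
have [/ih [n [nN dn nd]]|dN'] := leP (2 ^+ N)^-1 d.
  by exists n; split => //; exact: ltnW.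
exists N; split => //; rewrite invf_ple ?posrE ?exprn_gt0//.
by apply: lt_le_trans dN; rewrite invr_gt0 exprn_gt0.
Qed.

Lemma mul3n_leq_exp2 i : (3 * i <= 2 ^ i.+1)%N.
Proof.
elim: i => [//|[//|i] ih].
by have := expn_gt0 2 i; move: ih; rewrite !expnS /=; lia.
Qed.

(** * Distance to a set of reals *)

Section distance.
Variables (R : realType) (S : set R).
Hypothesis S0 : S !=set0.

Definition dist (m : R) : R := inf [set `|m - s| | s in S].

Lemma has_inf_dist m : has_inf [set `|m - s| | s in S].
Proof.
split; first by have [s Ss] := S0; exists `|m - s|, s.
by exists 0 => _ [s _ <-].
Qed.

Lemma dist_ge e m : (forall s, S s -> e <= `|m - s|) -> e <= dist m.
Proof.
move=> eS; apply: lb_le_inf; first exact: (has_inf_dist m).1.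
by move=> _ [s Ss <-]; exact: eS.
Qed.

Lemma dist_le m s : S s -> dist m <= `|m - s|.
Proof. by move=> Ss; apply: ge_inf; [exact: (has_inf_dist m).2|exists s]. Qed.

Lemma dist_ge0 m : 0 <= dist m.
Proof. exact: dist_ge. Qed.

Lemma dist_eq0 m : S m -> dist m = 0.
Proof.
move=> Sm; apply/eqP; rewrite eq_le dist_ge0 andbT.
by apply: le_trans (dist_le m Sm) _; rewrite subrr normr0.
Qed.

Lemma dist_lipschitz x y : dist y - dist x <= `|y - x|.
Proof.
suff : dist y - `|y - x| <= dist x by lra.
apply: dist_ge => s Ss; have := dist_le y Ss; have := ler_normD (y - x) (x - s).
by rewrite (_ : y - x + (x - s) = y - s); lra.
Qed.

Lemma continuous_dist : continuous dist.
Proof. by apply: lipschitz1_continuous => x y; exact: dist_lipschitz. Qed.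

End distance.

(** * The eighth root *)

Section root8.
Variable R : realType.
Implicit Types m : R.

(** Nested square roots are continuous on the whole line and make eighth roots
    of powers of two computable; the link with real powers is [root8_powR]. *)
Definition root8 m := Num.sqrt (Num.sqrt (Num.sqrt m)).

Lemma root8_ge0 m : 0 <= root8 m.
Proof. exact: sqrtr_ge0. Qed.

Lemma root8_gt0 m : 0 < m -> 0 < root8 m.
Proof. by move=> m0; rewrite !sqrtr_gt0. Qed.

Lemma root80 : root8 0 = 0.
Proof. by rewrite /root8 !sqrtr0. Qed.

Lemma ler_root8 : {homo root8 : x y / x <= y}.
Proof. by move=> x y xy; rewrite !ler_wsqrtr. Qed.

Lemma root8X m : 0 <= m -> root8 (m ^+ 8) = m.
Proof.
move=> m0; rewrite /root8 (_ : m ^+ 8 = ((m ^+ 2) ^+ 2) ^+ 2); last by ring.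
by rewrite sqrtr_sqr ger0_norm ?exprn_ge0// sqrtr_sqr ger0_norm ?exprn_ge0//
  sqrtr_sqr ger0_norm.
Qed.

Lemma root8_powR m : 0 <= m -> root8 m = m `^ 8^-1.
Proof.
move=> m0; rewrite /root8 -!powR12_sqrt ?powR_ge0// -!powRrM.
by congr (_ `^ _); field.
Qed.

Lemma continuous_root8 : continuous root8.
Proof.
move=> m; rewrite /root8.
apply: (continuous_comp (f := fun m => Num.sqrt (Num.sqrt m)));
  last exact: sqrt_continuous.
by apply: continuous_comp; exact: sqrt_continuous.
Qed.

End root8.

(** * Bounding an integral through a countable cover *)

Section cover.
Local Open Scope ereal_scope.

(** A union bound: [f] is at most the sum of the functions
    [c i j * \1_(E i j)], because at each point where it is positive one term
    of the sum is already large enough.  The finite inner range records that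
    level [i] only involves the dyadic scales [j < N i]. *)
Lemma integral_le_cover d (T : measurableType d) (R : realType)
    (mu : {measure set T -> \bar R}) (D : set T) (f : T -> R)
    (E : nat -> nat -> set T) (c : nat -> nat -> R) (N : nat -> nat) :
  measurable D -> measurable_fun D f -> (forall z, D z -> (0 <= f z)%R) ->
  (forall i j, measurable (E i j)) -> (forall i j, (0 <= c i j)%R) ->
  (forall z, D z -> (0 < f z)%R ->
    exists i j, [/\ (j < N i)%N, E i j z & (f z <= c i j)%R]) ->
  \int[mu]_(z in D) (f z)%:E <=
    \sum_(i <oo) \sum_(j < N i) (c i j)%:E * mu (E i j).
Proof.
move=> mD mf f0 mE c0 cov.
pose t i j z : \bar R := (c i j)%:E * (\1_(E i j) z)%:E.
have t0 i j z : 0 <= t i j z by rewrite mule_ge0 ?lee_fin.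
have mt i j : measurable_fun D (t i j).
  apply: emeasurable_funM; first exact: measurable_cst.
  by apply/measurable_EFinP; exact: measurable_indic.
have st0 i z : 0 <= \sum_(j < N i) t i j z by apply: sume_ge0.
apply: (@le_trans _ _ (\int[mu]_(z in D) \sum_(i <oo) \sum_(j < N i) t i j z)).
  apply: ge0_le_integral => //.
  - by apply/measurable_EFinP.
  - apply: (@ge0_emeasurable_sum _ _ _ _
      (fun i z => \sum_(j < N i) t i j z) xpredT) => [i z _ _|i _] //.
    exact: emeasurable_sum.
  - move=> z Dz; have := f0 z Dz; rewrite le_eqVlt => /predU1P[<-|fz0].
      by apply: nneseries_ge0 => i _ _; exact: st0.
    have [i [j [jN Ez fc]]] := cov z Dz fz0.
    apply: (@le_trans _ _ (\sum_(j < N i) t i j z)); last first.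
      have := @nneseries_lim_ge R (fun i => \sum_(j < N i) t i j z) xpredT 0 i.+1
        (fun n _ _ => st0 n z).
      apply: le_trans; rewrite big_nat_recr//=.
      by apply: leeDr; apply: sume_ge0 => k _; exact: st0.
    rewrite (bigD1 (Ordinal jN))//= /t indicE mem_set// mule1.
    apply: (@le_trans _ _ (c i j)%:E); first by rewrite lee_fin.
    by apply: leeDl; apply: sume_ge0 => k _; exact: t0.
rewrite integral_nneseries//; last by move=> i; exact: emeasurable_sum.
apply: lee_nneseries => [i _ _|i _].
  by apply: integral_ge0 => z _.
rewrite ge0_integral_sum//; apply: lee_sum => j _.
rewrite ge0_integralZl//; last 2 first.
- by apply/measurable_EFinP; exact: measurable_indic.
- by rewrite lee_fin.
rewrite lee_wpmul2l ?lee_fin// integral_indic//.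
by apply: le_measure; rewrite ?inE//; exact: measurableI.
Qed.

End cover.

(** * Neighbourhoods of the diagonal *)

Section strip.
Local Open Scope ereal_scope.
Variable R : realType.
Notation mu := (@lebesgue_measure R).

Definition strip (A : set R) (r : R) : set (R * R) :=
  [set z | (A z.1 \/ A z.2) /\ (`|z.2 - z.1| < r)%R].

Lemma measurable_near_diagonal (r : R) :
  measurable [set z : R * R | (`|z.2 - z.1| < r)%R].
Proof.
rewrite [X in measurable X](_ : _ =
    (fun z : R * R => `|z.2 - z.1|%R) @^-1` `]-oo, r[%classic); last first.
  by apply/seteqP; split => z; rewrite /= in_itv.
rewrite -[X in measurable X]setTI.
have mf : measurable_fun setT (fun z : R * R => `|z.2 - z.1|%R).
  apply: (measurableT_comp (@normr_measurable R setT)).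
  by apply: measurable_funB; [exact: measurable_snd|exact: measurable_fst].
exact: mf.
Qed.

Lemma measurable_strip A r : measurable A -> measurable (strip A r).
Proof.
move=> mA; apply: measurableI; last exact: measurable_near_diagonal.
by apply: measurableU; rewrite -[X in measurable X]setTI;
  [exact: measurable_fst|exact: measurable_snd].
Qed.

(** Each of the two conditions [A z.1] and [A z.2] contributes the measure of
    [A] times the length [2 * r] of a section, the first by slicing along the
    first coordinate and the second along the other one. *)
Lemma measure_strip A r : measurable A -> (0 <= r)%R ->
  (mu \x mu) (strip A r) <= (4 * r)%:E * mu A.
Proof.
move=> mA r0.
pose B i : set (R * R) :=
  [set z | A (if i then z.1 else z.2) /\ (`|z.2 - z.1| < r)%R].
have mB i : measurable (B i).
  apply: measurableI; last exact: measurable_near_diagonal.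
  by case: i; rewrite -[X in measurable X]setTI;
    [exact: measurable_fst|exact: measurable_snd].
apply: (@le_trans _ _ ((mu \x mu) (B true `|` B false))).
  apply: le_measure; rewrite ?inE; [exact: measurable_strip| |].
    by apply: measurableU; exact: mB.
  by move=> z [[Az|Az] zr]; [left|right].
apply: (le_trans (measureU2 _ _ _)); [exact: mB..|].
rewrite (_ : 4 * r = 2 * r + 2 * r)%R; last by lra.
rewrite EFinD ge0_muleDl ?lee_fin ?mulr_ge0//.
have int : \int[mu]_x ((2 * r)%:E * (\1_A x)%:E) = (2 * r)%:E * mu A.
  rewrite ge0_integralZl//; last 2 first.
  - by apply/measurable_EFinP; exact: measurable_indic.
  - by rewrite lee_fin mulr_ge0.
  by rewrite integral_indic// setIT.
have ballE (x : R) : mu [set y | (`|y - x| < r)%R] = (2 * r)%:E.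
  rewrite (_ : 2 * r = r *+ 2)%R; last by rewrite mulr_natl.
  rewrite -(lebesgue_measure_ball x r0); congr (mu _).
  by rewrite -ball_normE /ball_; apply/seteqP; split => y /=; rewrite distrC.
apply: leeD.
- rewrite -int; rewrite /product_measure1/= le_eqVlt; apply/orP; left; apply/eqP.
  apply: eq_integral => x _ /=; rewrite indicE.
  case: (boolP (x \in A)) => [|xA].
    rewrite inE => xA; rewrite mule1 -(ballE x); congr (mu _).
    apply/seteqP; split=> y; rewrite /xsection/= inE; first by case.
    by move=> yr; split.
  rewrite mule0 (_ : xsection _ _ = set0) ?measure0//.
  rewrite -subset0 => y; rewrite /xsection/= inE => -[Ax _].
  by move: xA; rewrite mem_set.
- have /= := product_measure_unique (product_measure2E mu mu) (mB false).
  rewrite -int => ->.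
  rewrite /product_measure2/= le_eqVlt; apply/orP; left; apply/eqP.
  apply: eq_integral => x _ /=; rewrite indicE.
  case: (boolP (x \in A)) => [|xA].
    rewrite inE => xA; rewrite mule1 -(ballE x); congr (mu _).
    apply/seteqP; split=> y; rewrite /ysection/= inE distrC; first by case.
    by move=> yr; split.
  rewrite mule0 (_ : ysection _ _ = set0) ?measure0//.
  rewrite -subset0 => y; rewrite /ysection/= inE => -[Ax _].
  by move: xA; rewrite mem_set.
Qed.

End strip.

(** * The Cantor-type level structure *)

Section counterexample.
Variable R : realType.
Implicit Types (x y a b m s : R) (i j k n : nat).
Local Notation mu := (@lebesgue_measure R).

(** The doubly exponential growth makes [len k.+1] the square of [len k]; this
    is what leaves room for a weight growing like a power.  The factor [32]
    hidden in [k.+2.+3] makes the exponent of [top k] divisible by eight, and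
    the terms of the final series at most geometric from the first one on. *)
Definition expo k := (2 ^ k.+2.+3)%N.

Definition len k : R := (2 ^+ expo k)^-1.

(** Where [tent k.+1] is nonnegative, it is the distance to the complement of
    the set that survives after removing the gaps of levels at most [k]: that
    set is formed of intervals of length [len k], and folding each of them in
    its middle gives the distance to its ends.  On the removed gaps [tent k.+1]
    is negative, and so are all later ones. *)
Fixpoint tent k x : R :=
  if k is k'.+1 then Num.min (tent k' x) (len k' - tent k' x)
  else Num.min x (1 - x).

Definition plateau k : set R := [set x | len k < tent k x].

Lemma len_gt0 k : 0 < len k.
Proof. by rewrite invr_gt0 exprn_gt0. Qed.

Lemma expoS k : expo k.+1 = (2 * expo k)%N.
Proof. by rewrite /expo -expnS. Qed.

Lemma tent_anti j k x : (j <= k)%N -> tent k x <= tent j x.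
Proof.
elim: k => [|k ih]; first by rewrite leqn0 => /eqP ->.
rewrite leq_eqVlt => /predU1P[-> //|]; rewrite ltnS => /ih.
by apply: le_trans; rewrite /= ge_min lexx.
Qed.

Lemma tent_lipschitz k x y : tent k y - tent k x <= `|y - x|.
Proof.
elim: k x y => [|k ih] x y /=.
  have := ler_norm (y - x); have := ler_norm (x - y); rewrite distrC.
  by rewrite /Num.min; case: ifPn; case: ifPn; rewrite -?leNgt; lra.
have := ih x y; have := ih y x; rewrite distrC.
by rewrite /Num.min; case: ifPn; case: ifPn; rewrite -?leNgt; lra.
Qed.

Lemma continuous_tent k : continuous (tent k).
Proof. by apply: lipschitz1_continuous => x y; exact: tent_lipschitz. Qed.

Lemma measurable_tent k : measurable_fun setT (tent k).
Proof. by apply: continuous_measurable_fun; exact: continuous_tent. Qed.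

Lemma open_plateau k : open (plateau k).
Proof.
rewrite /plateau -[X in open X]/(tent k @^-1` [set t | len k < t]).
by apply: open_comp => [x _|]; [exact: continuous_tent|exact: open_gt].
Qed.

Lemma tent_lt0 j k x : plateau j x -> (j < k)%N -> tent k x < 0.
Proof.
move=> jx jk; apply: le_lt_trans (tent_anti x jk) _.
by rewrite /= gt_min subr_lt0 jx orbT.
Qed.

(** At level [k] the function [tent k] is negative on the lower gaps and larger
    than [len k] on the gap itself, and it is 1-Lipschitz. *)
Lemma plateau_sep j k x y : (j < k)%N -> plateau j x -> plateau k y ->
  len k < `|y - x|.
Proof.
move=> jk jx ky; apply: lt_le_trans (tent_lipschitz k x y).
by have := tent_lt0 jx jk; move: ky; rewrite /plateau /=; lra.
Qed.

Lemma plateau_inj j k x : plateau j x -> plateau k x -> j = k.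
Proof.
move=> jx kx; case: (ltngtP j k) => // jk.
  by have := plateau_sep jk jx kx; rewrite subrr normr0 ltNge ltW ?len_gt0.
by have := plateau_sep jk kx jx; rewrite subrr normr0 ltNge ltW ?len_gt0.
Qed.

Lemma plateau_itv k x : plateau k x -> x \in `]0, 1[.
Proof.
rewrite /plateau /= => kx; have := tent_anti x (leq0n k).
have := len_gt0 k; rewrite in_itv /= /Num.min.
by case: ifPn; rewrite -?leNgt; lra.
Qed.

Definition band k a b : set R := [set x | a <= tent k x <= b].

Lemma measurable_band k a b : measurable (band k a b).
Proof.
rewrite (_ : band k a b = tent k @^-1` `[a, b]%classic).
  by rewrite -[X in measurable X]setTI; exact: measurable_tent.
by apply/seteqP; split => x; rewrite /= in_itv.
Qed.

(** Folding at most doubles preimages: [tent k.+1 x] lies in an interval only if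
    [tent k x] lies in that interval or in its mirror image. *)
Lemma measure_band k a b : a <= b ->
  (lebesgue_measure (band k a b) <= ((2 ^+ k.+1) * (b - a))%:E)%E.
Proof.
elim: k a b => [|k ih] a b ab.
  apply: (@le_trans _ _ (lebesgue_measure
      (`[a, b]%classic `|` `[1 - b, 1 - a]%classic))).
    apply: le_measure; rewrite ?inE; [exact: measurable_band|exact: measurableU|].
    move=> x; rewrite /band /= !in_itv/= /Num.min.
    by case: ifPn => _ /andP[? ?]; [left|right]; apply/andP; split; lra.
  apply: (le_trans (measureU2 _ _ _)) => //=.
  rewrite !lebesgue_measure_itv/= !lte_fin.
  have [->|ab'] := eqVneq a b; first by rewrite ltxx ltxx adde0 subrr mulr0.
  have lt: a < b by rewrite lt_neqAle ab'.
  rewrite lt ifT; last lra.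
  by rewrite -!EFinB -EFinD lee_fin expr1; lra.
apply: (@le_trans _ _ (lebesgue_measure
    (band k a b `|` band k (len k - b) (len k - a)))).
  apply: le_measure; rewrite ?inE; [exact: measurable_band| |].
    by apply: measurableU; exact: measurable_band.
  move=> x; rewrite /band /= /Num.min.
  by case: ifPn => _ /andP[? ?]; [left|right]; apply/andP; split; lra.
apply: (le_trans (measureU2 _ _ _)); [exact: measurable_band..|].
apply: (le_trans (leeD (ih _ _ ab) (ih _ _ _))); first lra.
by rewrite -EFinD lee_fin [in leRHS]exprS; lra.
Qed.

(** * The function, its slopes and the weight *)

(** The exponents give [height k / len k = top k] and make [height k.+1] the
    fourth power of [2 ^+ expo k], whereas [top k] is only the third. *)
Definition height k : R := 2 ^+ (2 * expo k).
Definition top k : R := 2 ^+ (3 * expo k).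

(** On the null set of points outside all plateaus the value is [height 0], the
    default index of [xget]. *)
Definition profile x : R := height (xget 0%N [set k | plateau k x]).

Definition slopes : set R :=
  [set s | s = 0 \/ exists k, height k / 2 <= s <= top k].

Definition weight m : R := root8 m + dist slopes m ^+ 2.

Lemma profileE k x : plateau k x -> profile x = height k.
Proof.
move=> kx; rewrite /profile; congr height; case: xgetP => [j _ jx|/(_ k)//].
exact: plateau_inj jx kx.
Qed.

Lemma measurable_profile : measurable_fun setT profile.
Proof.
have mp k : measurable (plateau k) by apply: open_measurable; exact: open_plateau.
rewrite -(setUv (\bigcup_k plateau k)); apply/measurable_funU.
- by apply: bigcup_measurable => k _; exact: mp.
- by apply: measurableC; apply: bigcup_measurable => k _; exact: mp.
split.
- apply/(measurable_fun_bigcup _ mp) => k.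
  apply: (eq_measurable_fun (cst (height k))); last exact: measurable_cst.
  by move=> x; rewrite inE => kx; rewrite (profileE kx).
- apply: (eq_measurable_fun (cst (height 0))); last exact: measurable_cst.
  move=> x; rewrite inE => nx; rewrite /profile; case: xgetP => //= k _ kx.
  by exfalso; apply: nx; exists k.
Qed.

Lemma is_derive_profile k x : plateau k x -> is_derive x 1 profile 0.
Proof.
move=> kx; apply: near_eq_is_derive (is_derive_cst (height k) x 1).
have := open_nbhs_nbhs (conj (@open_plateau k) kx).
by apply: filterS => y ky; rewrite (profileE ky).
Qed.

Lemma outside_plateaus x : x \in `]0, 1[ -> (forall k, ~ plateau k x) ->
  forall k, band k 0 (len k) x.
Proof.
move=> x01 nx k; rewrite /band /=; apply/andP; split; last first.
  by rewrite leNgt; apply/negP => ?; exact: (nx k).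
elim: k => [|k ih] /=; move: x01; rewrite in_itv/= le_min => /andP[x0 x1].
  by apply/andP; split; lra.
by rewrite ih subr_ge0 leNgt; apply/negP => ?; exact: (nx k).
Qed.

Lemma plateau_band k x : plateau k.+1 x -> band k 0 (len k) x.
Proof.
move=> kx; have := len_gt0 k.+1; rewrite /band /=; move: kx.
by rewrite /plateau /= lt_min => /andP[? ?] ?; apply/andP; split; lra.
Qed.

Lemma height_len k : height k / len k = top k.
Proof. by rewrite /height /len /top invrK -exprD; congr (_ ^+ _); lia. Qed.

Lemma expo_gt0 k : (0 < expo k)%N. Proof. by rewrite expn_gt0. Qed.

Lemma ltn_expo k : (k < expo k)%N.
Proof.
by apply: leq_trans (ltn_expl k (ltnSn 1)) _; rewrite leq_exp2l// (leq_addl 5 k).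
Qed.

Lemma ler_expo j k : (j <= k)%N -> (expo j <= expo k)%N.
Proof. by move=> jk; rewrite leq_exp2l. Qed.

Lemma height_double j k : (j < k)%N -> 2 * height j <= height k.
Proof.
move=> jk; rewrite -exprS ler_eXn2l ?ltr1n//.
have := ler_expo jk; rewrite expoS; have := expo_gt0 j; lia.
Qed.

(** The quotient is at least half of [height k] since the distance is at most
    [1] and the lower height is at most half of the higher one; it is at most
    [height k / len k] by separation. *)
Lemma slopes_profile j k x y : (j < k)%N -> plateau j x -> plateau k y ->
  height k / 2 <= `|profile y - profile x| / `|y - x| <= top k.
Proof.
move=> jk jx ky; have d0 := plateau_sep jk jx ky.
have d1 : `|y - x| <= 1.
  have := plateau_itv jx; have := plateau_itv ky; rewrite !in_itv/=.
  by move=> ? ?; rewrite ler_norml; apply/andP; split; lra.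
have l0 := len_gt0 k; have h := height_double jk.
have hj0 : 0 < height j by rewrite exprn_gt0.
rewrite (profileE jx) (profileE ky) ger0_norm; last by lra.
apply/andP; split.
  rewrite ler_pdivlMr; last exact: lt_trans d0.
  by apply: (@le_trans _ _ (height k / 2)); [rewrite ler_piMr//; lra|lra].
rewrite -height_len ler_pdivrMr ?(lt_trans l0)//.
apply: (@le_trans _ _ (height k / len k * len k)).
  by rewrite divfK ?gt_eqF//; lra.
by rewrite ler_pM2l ?ltW// divr_gt0//; lra.
Qed.

Lemma root8_top k : root8 (top k) = 2 ^+ (3 * 2 ^ k.+2).
Proof.
rewrite -[RHS]root8X ?exprn_ge0// -exprM; congr (root8 (_ ^+ _)).
by rewrite /expo !expnS; lia.
Qed.

Lemma expoE k : expo k = (32 * 2 ^ k)%N.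
Proof. by rewrite -(expnD 2 5). Qed.

(** * Growth of the weight *)

Lemma slopes_neq0 : slopes !=set0.
Proof. by exists 0; left. Qed.

Lemma weight_ge0 m : 0 <= weight m.
Proof. by rewrite addr_ge0 ?root8_ge0 ?sqr_ge0. Qed.

Lemma weight_gt0 m : 0 < m -> 0 < weight m.
Proof. by move=> m0; rewrite ltr_pwDl ?root8_gt0 ?sqr_ge0. Qed.

Lemma continuous_weight : continuous weight.
Proof.
move=> m; apply: cvgD; first exact: continuous_root8.
rewrite expr2; under eq_fun do rewrite expr2.
by apply: cvgM; exact: (continuous_dist slopes_neq0).
Qed.

Lemma weight_slopes s : slopes s -> weight s = root8 s.
Proof.
by move=> Ss; rewrite /weight (dist_eq0 slopes_neq0 Ss) expr0n addr0.
Qed.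

(** The elementary bound [ln m <= C * m `^ C^-1], with [C = 16 * theta], gives
    [ln m `^ theta <= C `^ theta * m `^ 16^-1], so that the quotient is at least
    a constant times [m `^ 16^-1]. *)
Lemma cvgr_weight_ln theta : 0 < theta ->
  weight m / (ln m `^ theta) @[m --> +oo] --> +oo.
Proof.
move=> t0; apply/cvgryPge => A.
pose C := 16 * theta; have C0 : 0 < C by rewrite mulr_gt0.
near=> m.
have m1 : 1 < m by near: m; apply: nbhs_pinfty_gt; rewrite num_real.
have mD : (`|A| * C `^ theta) `^ 16 < m.
  by near: m; apply: nbhs_pinfty_gt; rewrite num_real.
have m0 : 0 < m by apply: lt_trans m1.
have l0 : 0 < ln m by rewrite ln_gt0.
have lt0 : 0 < ln m `^ theta by rewrite powR_gt0.
rewrite ler_pdivlMr//; apply: (@le_trans _ _ (root8 m)); last first.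
  by rewrite lerDl sqr_ge0.
rewrite root8_powR ?(ltW m0)//.
have lnm : ln m <= C * m `^ C^-1.
  rewrite -ler_pdivrMl// -ln_powR ltW//.
  have p0 : 0 < m `^ C^-1 by rewrite powR_gt0.
  have := @le_ln1Dx R (m `^ C^-1 - 1); rewrite addrCA subrr addr0.
  by move=> H; apply: le_lt_trans (H _) _; lra.
have lnt : ln m `^ theta <= C `^ theta * m `^ 16^-1.
  rewrite (_ : 16^-1 = C^-1 * theta); last first.
    by rewrite /C; field; rewrite gt_eqF.
  rewrite powRrM -powRM ?powR_ge0 ?(ltW C0)//.
  rewrite (ge0_ler_powR (ltW t0))// nnegrE ?(ltW l0)//.
  by rewrite mulr_ge0 ?powR_ge0 ?(ltW C0).
have m16 : `|A| * C `^ theta <= m `^ 16^-1.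
  have D0 : 0 <= `|A| * C `^ theta by rewrite mulr_ge0 ?powR_ge0.
  rewrite (_ : _ * _ = ((`|A| * C `^ theta) `^ 16) `^ 16^-1); last first.
    by rewrite -powRrM divff// powRr1.
  by apply: (@ge0_ler_powR R 16^-1);
    rewrite ?nnegrE ?powR_ge0 ?invr_ge0 ?(ltW m0) ?(ltW mD).
apply: (@le_trans _ _ (`|A| * ln m `^ theta)).
  by rewrite ler_pM2r// ler_norm.
apply: (@le_trans _ _ (`|A| * (C `^ theta * m `^ 16^-1))).
  by rewrite ler_wpM2l.
rewrite mulrA (_ : 8^-1 = 16^-1 + 16^-1 :> R); last by field.
by rewrite powRD ?gt_eqF ?implybT// ler_wpM2r ?powR_ge0.
Unshelve. all: by end_near. Qed.

(** No slope lies strictly between [top k] and [height k.+1 / 2], and the latter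
    is at least [4 * top k]. *)
Lemma dist_slopes_gap k m : 2 * top k <= m <= 3 * top k ->
  top k <= dist slopes m.
Proof.
move=> /andP[m2 m3]; have t0 : 0 < top k by rewrite exprn_gt0.
apply: dist_ge => [|s [->|[j /andP[hs st]]]]; first exact: slopes_neq0.
  by rewrite subr0 ger0_norm; lra.
have [jk|kj] := leqP j k.
  have : top j <= top k by rewrite ler_eXn2l ?ltr1n// leq_mul2l ler_expo.
  by move=> jk'; rewrite ger0_norm; lra.
have : 8 * top k <= height j.
  rewrite (_ : 8 = 2 ^+ 3); last by ring.
  rewrite -exprD ler_eXn2l ?ltr1n//.
  have := ler_expo kj; rewrite expoS.
  have : (2 ^ 3 <= expo k)%N by rewrite leq_exp2l.
  lia.
by move=> hj; rewrite ler0_norm; lra.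
Qed.

(** The squared distance makes the part of the integral over a single gap of
    [slopes] at least [top k / 9], which is unbounded in [k]. *)
Lemma integral_weight :
  (\int[mu]_(m in `[1%R, +oo[) (weight m / m ^+ 2)%R%:E = +oo)%E.
Proof.
apply/eqyP => A A0.
have [k Ak] : exists k, 9 * A <= top k.
  exists (Num.bound (9 * A)); apply: le_trans (ltW (archi_boundP _)) _.
    by rewrite mulr_ge0// ltW.
  rewrite /top -natrX ler_nat; apply: ltnW.
  apply: leq_trans (ltn_expl _ (ltnSn 1)) _.
  by rewrite leq_exp2l// (leq_trans (ltnW (ltn_expo _)))// leq_pmull.
have t1 : 1 <= top k by rewrite exprn_ege1// ler1n.
pose J : set R := `[2 * top k, 3 * top k]%classic.
have mJ : measurable J by exact: measurable_itv.
have J1 : J `<=` `[1, +oo[%classic.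
  by move=> m; rewrite /J/= !in_itv/= andbT => /andP[? _]; lra.
have mf : measurable_fun setT (fun m => (weight m / m ^+ 2)%:E).
  apply/measurable_EFinP; apply: measurable_funM.
    by apply: continuous_measurable_fun; exact: continuous_weight.
  by apply: (measurableT_comp (@measurable_invr R)); exact: measurable_funX.
have f0 m : (0 <= (weight m / m ^+ 2)%:E)%E.
  by rewrite lee_fin divr_ge0 ?weight_ge0 ?sqr_ge0.
apply: (@le_trans _ _ (\int[mu]_(m in J) (9^-1)%:E)%E).
  rewrite integral_cst//= lebesgue_measure_itv/= lte_fin ifT; last by lra.
  by rewrite -EFinB -EFinM lee_fin; lra.
apply: (@le_trans _ _ (\int[mu]_(m in J) (weight m / m ^+ 2)%:E)%E).
  apply: ge0_le_integral => //.
    by apply: measurable_funTS.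
  move=> m; rewrite /J/= in_itv/= => mJk; rewrite lee_fin.
  have := dist_slopes_gap mJk; move: mJk => /andP[m2 m3] dm.
  rewrite ler_pdivlMr ?exprn_gt0//; last by lra.
  have r0 := root8_ge0 m; rewrite /weight.
  have : top k ^+ 2 <= dist slopes m ^+ 2 by rewrite lerXn2r// nnegrE; lra.
  have : m ^+ 2 <= (3 * top k) ^+ 2 by rewrite lerXn2r// nnegrE; lra.
  by rewrite exprMn; lra.
apply: ge0_subset_integral => //; exact: measurable_funTS.
Qed.

(** * Non-constancy and the derivative *)

Lemma not_essentially_constant_profile :
  ~ essentially_constant `]0, 1[ profile.
Proof.
move=> [c cP].
have plateauP k x : plateau k x -> height k = c.
  move=> kx; have [||y ky <-] := ae_open_exists (@open_plateau k) _ _ cP.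
  - by exists x.
  - by move=> y /plateau_itv.
  by rewrite (profileE ky).
have l0 := len_gt0 0; have l1 := len_gt0 1.
(* Witnesses: 1/2 lies in the gap of level 0 and [len 0 / 2] in one of
   level 1. *)
have l : 4 * len 1 <= len 0.
  rewrite /len -ler_pdivlMl// -invfM lef_pV2 ?posrE ?mulr_gt0 ?exprn_gt0//.
  by rewrite (_ : 4 = 2 ^+ 2) -?exprD ?ler_eXn2l ?ltr1n//; ring.
have l2 : 4 * len 0 <= 1.
  rewrite ler_pdivrMr ?exprn_gt0// mul1r.
  by rewrite (_ : 4 = 2 ^+ 2) ?ler_eXn2l ?ltr1n//; ring.
have h0 : height 0 = c.
  by apply: (plateauP _ 2^-1); rewrite /plateau /= lt_min; apply/andP; split; lra.
have h1 : height 1 = c.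
  apply: (plateauP _ (len 0 / 2)); rewrite /plateau /=.
  rewrite (@min_l _ _ (len 0 / 2) (1 - len 0 / 2)); last by lra.
  by rewrite lt_min; apply/andP; split; lra.
have := @height_double 0 1 isT; rewrite h0 h1.
have : 0 < c by rewrite -h0 exprn_gt0.
lra.
Qed.

Lemma ae_is_derive_profile :
  {ae mu, forall x, `]0, 1[%classic x -> is_derive x 1 profile 0}.
Proof.
exists (\bigcap_k band k 0 (len k)); split.
- by apply: bigcap_measurable => // k _; exact: measurable_band.
- apply/eqP; rewrite eq_le measure_ge0 andbT; apply/lee_addgt0Pr => e e0.
  rewrite add0e; pose k := Num.bound e^-1.
  apply: (@le_trans _ _ (mu (band k 0 (len k)))).
    apply: le_measure; rewrite ?inE; [|exact: measurable_band|exact: bigcap_inf].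
    by apply: bigcap_measurable => // i _; exact: measurable_band.
  apply: (le_trans (measure_band _ _)); first exact/ltW/len_gt0.
  rewrite lee_fin subr0 ler_pdivrMr ?exprn_gt0//.
  rewrite -ler_pdivrMl// mulrC.
  have /ltW ke : e^-1 < k%:R.
    by have := @archi_boundP R e^-1; apply; rewrite invr_ge0 ltW.
  apply: (@le_trans _ _ (2 ^+ k.+1 * 2 ^+ k)).
    rewrite ler_pM2l ?exprn_gt0//; apply: le_trans ke _.
    by rewrite -natrX ler_nat ltnW// ltn_expl.
  rewrite -exprD ler_eXn2l ?ltr1n// expoE.
  have := ltn_expl k (ltnSn 1); lia.
- move=> x /=; rewrite not_implyE => -[x01 nd] k _.
  apply: outside_plateaus => // j jx; apply: nd; exact: is_derive_profile jx.
Qed.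

(** * Finiteness of the energy *)

Definition energy (z : R * R) : R :=
  weight (`|profile z.2 - profile z.1| / `|z.2 - z.1|) * (1 / `|z.2 - z.1|).

Lemma energy_ge0 z : 0 <= energy z.
Proof. by rewrite mulr_ge0 ?weight_ge0 ?divr_ge0. Qed.

Lemma measurable_energy : measurable_fun setT energy.
Proof.
have mn (h : R -> R) : measurable_fun setT h ->
    measurable_fun setT (fun z : R * R => `|h z.2 - h z.1|).
  move=> mh; apply: (measurableT_comp (@normr_measurable R setT)).
  by apply: measurable_funB; apply: (measurableT_comp mh);
    [exact: measurable_snd|exact: measurable_fst].
have mi : measurable_fun setT (fun z : R * R => `|z.2 - z.1|^-1).
  by apply: (measurableT_comp (@measurable_invr R)); exact: (mn id).
apply: measurable_funM.
  apply: (measurableT_comp (f := weight)).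
    by apply: continuous_measurable_fun; exact: continuous_weight.
  by apply: measurable_funM => //; apply: mn; exact: measurable_profile.
by apply: measurable_funM.
Qed.

(** Bound for the energy of a pair whose higher level is [i.+1] at the dyadic
    scale [n]: the weight of the largest slope times the inverse distance. *)
Definition scale_bound i n : R := root8 (top i.+1) * 2 ^+ n.+1.

Lemma energyC x y : energy (x, y) = energy (y, x).
Proof. by rewrite /energy /= (distrC y x) (distrC (profile y)). Qed.

(** The higher point of the pair lies on a plateau of level [i.+1], hence in
    [band i 0 (len i)], and separation excludes the scales beyond
    [expo i.+1]. *)
Lemma energy_plateaus i j x y : (j < i.+1)%N -> plateau j x -> plateau i.+1 y ->
  exists n, [/\ (n < expo i.+1)%N, strip (band i 0 (len i)) (2 ^+ n)^-1 (x, y)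
    & energy (x, y) <= scale_bound i n].
Proof.
move=> ji jx iy; have sep := plateau_sep ji jx iy.
have d0 : 0 < `|y - x| by apply: lt_trans sep; exact: len_gt0.
have d1 : `|y - x| < 1.
  have := plateau_itv jx; have := plateau_itv iy; rewrite !in_itv/=.
  by move=> ? ?; rewrite ltr_norml; apply/andP; split; lra.
have [n [nN dn nd]] := dyadic_scale d1 (ltW sep).
exists n; split => //; first by split => //=; right; exact: plateau_band.
have sl := slopes_profile ji jx iy.
rewrite /energy /= weight_slopes; last by right; exists i.+1.
rewrite ler_pM ?root8_ge0 ?divr_ge0// ?div1r//.
by apply: ler_root8; case/andP: sl.
Qed.

Lemma strip_sym A r x y : strip A r (x, y) -> strip A r (y, x).
Proof. by move=> [[|] /= Ax xy]; split; rewrite 1?distrC//=; [right|left]. Qed.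

(** A point outside all plateaus lies in every band, and [scale_bound i 0] is
    unbounded in [i]; so the cover bounds the energy on the exceptional null set
    as well. *)
Lemma energy_outside z w : z.1 \in `]0, 1[ -> z.2 \in `]0, 1[ ->
  w = z.1 \/ w = z.2 -> (forall k, ~ plateau k w) ->
  exists i, strip (band i 0 (len i)) (2 ^+ 0)^-1 z /\ energy z <= scale_bound i 0.
Proof.
move=> z1 z2 wz nw; exists (Num.bound (energy z)).
have w01 : w \in `]0, 1[ by case: wz => ->.
have bw := outside_plateaus w01 nw; split.
  split; first by case: wz bw => -> bw; [left|right].
  move: z1 z2; rewrite expr0 invr1 !in_itv /= => ? ?.
  by rewrite ltr_norml; apply/andP; split; lra.
apply: le_trans (ltW (archi_boundP (energy_ge0 z))) _.
rewrite /scale_bound root8_top -exprD -natrX ler_nat.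
set n := Num.bound _; apply: ltnW; apply: leq_trans (ltn_expl n (ltnSn 1)) _.
rewrite leq_exp2l// (leq_trans _ (leq_addr _ _))//.
rewrite (leq_trans (ltnW (ltn_expl n (ltnSn 1))))//.
by rewrite (leq_trans _ (leq_pmull _ _))// leq_exp2l// (leq_addl 3 n).
Qed.

Lemma energy_cover z : z.1 \in `]0, 1[ -> z.2 \in `]0, 1[ -> 0 < energy z ->
  exists i n, [/\ (n < expo i.+1)%N, strip (band i 0 (len i)) (2 ^+ n)^-1 z
    & energy z <= scale_bound i n].
Proof.
move=> z1 z2 ez.
have [[j jx]|nx] := pselect (exists k, plateau k z.1); last first.
  have [||i [? ?]] := @energy_outside z z.1 z1 z2.
  - by left.
  - by move=> k kx; apply: nx; exists k.
  by exists i, 0%N; split => //; exact: expo_gt0.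
have [[k ky]|ny] := pselect (exists k, plateau k z.2); last first.
  have [||i [? ?]] := @energy_outside z z.2 z1 z2.
  - by right.
  - by move=> k kx; apply: ny; exists k.
  by exists i, 0%N; split => //; exact: expo_gt0.
case: z z1 z2 ez jx ky => x y /= z1 z2 ez jx ky.
case: (ltngtP j k) => jk.
- case: k jk ky => // i ji iy; exists i.
  exact: energy_plateaus ji jx iy.
- case: j jk jx => // i ki ix; exists i.
  have [n [nN sn en]] := energy_plateaus ki ky ix.
  by exists n; split => //; [exact: strip_sym|rewrite energyC].
- move: ez; rewrite /energy /= (profileE jx) (profileE ky) jk subrr normr0 mul0r.
  rewrite weight_slopes; last by left.
  by rewrite root80 mul0r ltxx.
Qed.

(** The factors [2 ^+ n] of the bound and [2 ^- n] of the strip cancel, so all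
    scales contribute equally.  Comparing exponents of two, what remains is
    [3 * i + 6 <= 8 * 2 ^ i]. *)
Lemma strip_sum_le i :
  (\sum_(n < expo i.+1) (scale_bound i n)%:E *
     (mu \x mu) (strip (band i 0 (len i)) (2 ^+ n)^-1) <=
   (32 / (2 ^ i.+1)%:R)%:E)%E.
Proof.
have mb : measurable (band i 0 (len i)) by exact: measurable_band.
apply: (@le_trans _ _ (\sum_(n < expo i.+1)
    (8 * root8 (top i.+1) * (2 ^+ i.+1 * len i))%:E)%E).
  apply: lee_sum => n _.
  have p0 : 0 < 2 ^+ n :> R by rewrite exprn_gt0.
  apply: (@le_trans _ _ ((scale_bound i n)%:E *
      ((4 * (2 ^+ n)^-1)%:E * (2 ^+ i.+1 * len i)%:E))%E).
    apply: lee_wpmul2l.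
      by rewrite lee_fin mulr_ge0 ?root8_ge0 ?exprn_ge0.
    apply: le_trans (measure_strip mb _) _; first by rewrite invr_ge0 ltW.
    apply: lee_wpmul2l; first by rewrite lee_fin mulr_ge0 ?invr_ge0 ?ltW.
    by have := measure_band i (ltW (len_gt0 i)); rewrite subr0.
  rewrite -!EFinM lee_fin /scale_bound exprS le_eqVlt; apply/orP; left.
  by apply/eqP; field; rewrite gt_eqF.
rewrite sumEFin lee_fin sumr_const card_ord root8_top -[leLHS]mulr_natl.
rewrite ler_pdivlMr ?ltr0n ?expn_gt0// !natrX /len.
rewrite !mulrA mulrAC ler_pdivrMr ?exprn_gt0//.
rewrite (_ : 8 = 2 ^+ 3); last by ring.
rewrite (_ : 32 = 2 ^+ 5); last by ring.
rewrite -!exprD ler_eXn2l ?ltr1n//.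
by have := mul3n_leq_exp2 i; have := expn_gt0 2 i; rewrite expoE !expnS /=; lia.
Qed.


Lemma integral_energy_fin :
  (\int[mu \x mu]_(z in `]0%R, 1%R[ `*` `]0%R, 1%R[) (energy z)%:E < +oo)%E.
Proof.
apply: (@le_lt_trans _ _ 32%:E); last exact: ltry.
apply: (@le_trans _ _ (\sum_(i <oo) \sum_(n < expo i.+1) (scale_bound i n)%:E *
    (mu \x mu) (strip (band i 0 (len i)) (2 ^+ n)^-1))%E).
  apply: (@integral_le_cover _ _ R (mu \x mu)%E _ _
    (fun i n => strip (band i 0 (len i)) (2 ^+ n)^-1) scale_bound
    (fun i => expo i.+1)).
  - by apply: measurableX; exact: measurable_itv.
  - by apply: measurable_funTS; exact: measurable_energy.
  - by move=> z _; exact: energy_ge0.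
  - by move=> i n; apply: measurable_strip; exact: measurable_band.
  - by move=> i n; rewrite mulr_ge0 ?root8_ge0 ?exprn_ge0.
  - by move=> z [z1 z2] ez; exact: energy_cover.
apply: le_trans (epsilon_trick0 xpredT (ler0n R 32)).
apply: lee_nneseries => [i _ _|i _]; last exact: strip_sum_le.
apply: sume_ge0 => n _; rewrite mule_ge0// lee_fin.
by rewrite mulr_ge0 ?root8_ge0 ?exprn_ge0.
Qed.

End counterexample.

Theorem theorem1p1 (R : realType) :
  exists (omega : R -> R) (u : R -> R),
    [/\ {within `[0, +oo[, continuous omega},
        (forall m : R, 0 <= m -> 0 <= omega m),
        measurable_fun (`]0, 1[ : set R) u &
        ~ essentially_constant `]0, 1[ u] /\
    [/\ (forall m : R, 0 < m -> 0 < omega m),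
        (\int[lebesgue_measure]_(m in (`[1%R, +oo[ : set R))
           (omega m / m ^+ 2)%R%:E = +oo)%E,
        (\int[lebesgue_measure \x lebesgue_measure]_(z in
             (`]0%R, 1%R[ `*` `]0%R, 1%R[ : set (R * R)))
           (omega (`|u z.2 - u z.1| / `|z.2 - z.1|) * (1 / `|z.2 - z.1|))%R%:E
           < +oo)%E,
        (forall theta : R, 0 < theta ->
           omega m / (ln m `^ theta) @[m --> +oo%R] --> +oo%R) &
        {ae lebesgue_measure, forall x : R, `]0, 1[%classic x ->
           is_derive x 1 u 0}].
Proof.
exists (@weight R), (@profile R); split; split.
- by apply: continuous_subspaceT; exact: continuous_weight.
- by move=> m _; exact: weight_ge0.
- by apply: measurable_funTS; exact: measurable_profile.
- exact: not_essentially_constant_profile.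
- exact: weight_gt0.
- exact: integral_weight.
- exact: integral_energy_fin.
- exact: cvgr_weight_ln.
- exact: ae_is_derive_profile.
Qed.
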